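(* Let $G$ be a finite non-abelian group. Then the graph $\Gamma^{**}(G)$ is the line graph of some graph if and only if the centralizer $C_G(x)$ of every non-central element $x$ of $G$ is abelian.
   Context: All graphs are simple (no loops or multiple edges) and undirected. The commuting graph $\Gamma(G)$ of a group $G$ is the simple undirected graph whose vertex set is the set of all elements of $G$, in which two distinct elements $x$ and $y$ are adjacent if and only if $xy=yx$. A dominating (dominant) vertex of a graph is a vertex adjacent to every other vertex. The graph $\Gamma^{**}(G)$ is the induced subgraph of $\Gamma(G)$ obtained by deleting all dominating vertices of $\Gamma(G)$; the set of dominating vertices of $\Gamma(G)$ is the center $Z(G)$, so $\Gamma^{**}(G)$ is the induced subgraph on $G\setminus Z(G)$. The line graph $L(\Gamma)$ of a graph $\Gamma$ is the graph whose vertices are the edges of $\Gamma$, two distinct vertices of $L(\Gamma)$ being adjacent if and only if the corresponding edges of $\Gamma$ share an endpoint. A graph is ''the line graph of some graph'' if it is isomorphic to $L(\Gamma)$ for some simple graph $\Gamma$. $C_G(x)$ denotes the centralizer of $x$ in $G$, and an element is non-central if it does not lie in $Z(G)$. *)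

(* Defs.v *)
From HB Require Import structures.
From mathcomp Require Import all_boot all_fingroup all_solvable.
From mathcomp Require Import boolp classical_sets.

Set Implicit Arguments.
Unset Strict Implicit.
Unset Printing Implicit Defensive.

Record sgraph : Type := SGraph {
  vertex :> Type;
  adj : vertex -> vertex -> Prop;
  adj_sym : forall x y, adj x y -> adj y x;
  adj_irrefl : forall x, ~ adj x x
}.

Definition graph_iso (A B : sgraph) : Prop :=
  exists2 f : A -> B, bijective f & forall x y : A, adj x y <-> adj (f x) (f y).

Section Induced.
Variables (A : sgraph) (P : A -> Prop).

Definition induced_adj (u v : {x : A | P x}) : Prop := adj (sval u) (sval v).

Lemma induced_adj_sym u v : induced_adj u v -> induced_adj v u.
Proof. exact: adj_sym. Qed.

Lemma induced_adj_irrefl u : ~ induced_adj u u.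
Proof. exact: adj_irrefl. Qed.

Definition induced_subgraph : sgraph :=
  SGraph induced_adj_sym induced_adj_irrefl.

End Induced.

Definition dominating (A : sgraph) (x : A) : Prop :=
  forall y : A, y <> x -> adj x y.

Definition delete_dominating (A : sgraph) : sgraph :=
  induced_subgraph (fun x : A => ~ dominating x).

Section LineGraph.
Variable A : sgraph.

Definition is_edge (e : set A) : Prop :=
  exists x y : A, adj x y /\ e = [set x; y]%classic.

Definition edge : Type := {e : set A | is_edge e}.

Definition line_adj (e f : edge) : Prop :=
  e <> f /\ exists x : A, sval e x /\ sval f x.

Lemma line_adj_sym e f : line_adj e f -> line_adj f e.
Proof. by case=> nef [x [ex fx]]; split; [exact: nesym | exists x]. Qed.

Lemma line_adj_irrefl e : ~ line_adj e e.
Proof. by case. Qed.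

Definition line_graph : sgraph := SGraph line_adj_sym line_adj_irrefl.

End LineGraph.

(* The root graph is not required to be finite. *)
Definition is_line_graph (A : sgraph) : Prop :=
  exists B : sgraph, graph_iso A (line_graph B).

Section CommutingGraph.
Variables (gT : finGroupType) (G : {group gT}).

Definition commuting_adj (u v : {x : gT | x \in G}) : Prop :=
  u <> v /\ commute (val u) (val v).

Lemma commuting_adj_sym u v : commuting_adj u v -> commuting_adj v u.
Proof. by case=> nuv cuv; split; [exact: nesym | exact: commute_sym]. Qed.

Lemma commuting_adj_irrefl u : ~ commuting_adj u u.
Proof. by case. Qed.

Definition commuting_graph : sgraph :=
  SGraph commuting_adj_sym commuting_adj_irrefl.

End CommutingGraph.

(* Main.v *)
Require Import Defs.
From HB Require Import structures.
From mathcomp Require Import all_boot all_fingroup all_solvable.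
From mathcomp Require Import boolp classical_sets.

(** A line graph contains no induced claw: of three edges meeting a given edge
    [e], two meet it at the same endpoint, hence meet each other
    ([line_graph_claw_free]).  If some non-central [x] has a non-abelian
    centralizer, choose non-commuting [a] and [b] in it: then [a], [b] and
    [a * b] are pairwise non-commuting while [x] commutes with all three, so
    they form a claw centred at [x] in the graph.

    Conversely, if all these centralizers are abelian, two non-central elements
    commute exactly when they have the same centralizer
    ([commute_centralizer_eq]).  The graph is then a disjoint union of complete
    graphs, one for each centralizer, and such a graph is the line graph of a
    disjoint union of stars ([fiber_graph_is_line_graph]). *)

Set Implicit Arguments.
Unset Strict Implicit.
Unset Printing Implicit Defensive.

Lemma inj_surj_bijective (T U : Type) (f : T -> U) :
  injective f -> (forall y, exists x, f x = y) -> bijective f.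
Proof.
move=> f_inj f_surj; pose g y := projT1 (cid (f_surj y)).
have gK : cancel g f by move=> y; exact: projT2 (cid (f_surj y)).
by exists g => // x; apply: f_inj; exact: gK.
Qed.

Lemma sval_prop_inj (T : Type) (P : T -> Prop) :
  injective (sval : {x : T | P x} -> T).
Proof.
move=> [x Px] [y Py] /= exy; subst y.
by congr exist; exact: Prop_irrelevance.
Qed.

(** * Line graphs contain no claw *)

Section ClawFree.

Definition has_claw (A : sgraph) : Prop :=
  exists x a b c : A,
    [/\ adj x a, adj x b & adj x c] /\
    [/\ a <> b, b <> c & a <> c] /\ [/\ ~ adj a b, ~ adj b c & ~ adj a c].

Lemma graph_iso_claw (A B : sgraph) : graph_iso A B -> has_claw A -> has_claw B.
Proof.
case=> f /bij_inj f_inj f_adj [x [a [b [c [[xa xb xc] [[ab bc ac] [nab nbc nac]]]]]]].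
exists (f x), (f a), (f b), (f c).
split; first by split; apply/f_adj.
by split; split; (move/f_inj || move/f_adj).
Qed.

(** Pigeonhole on the two endpoints of the central edge. *)
Lemma line_graph_claw_free (A : sgraph) : ~ has_claw (line_graph A).
Proof.
move=> [e [a [b [c [[ea eb ec] [[ab bc ac] [nab nbc nac]]]]]]].
have [u [v [_ e_uv]]] := svalP e.
have meets f : adj e f -> sval f u \/ sval f v.
  by case=> _ [z []]; rewrite e_uv => -[->|->]; [left | right].
have common f g z : f <> g -> ~ @adj (line_graph A) f g ->
    sval f z -> sval g z -> False.
  by move=> nfg nadj fz gz; apply: nadj; split=> //; exists z.
case: (meets _ ea) (meets _ eb) (meets _ ec) => [pa|pa] [pb|pb] [pc|pc];
  solve [exact: common ab nab pa pb | exact: common bc nbc pb pc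
       | exact: common ac nac pa pc].
Qed.

End ClawFree.

(** * Disjoint unions of complete graphs are line graphs *)

Section StarForest.
Variables (V T : Type) (phi : V -> T).

(** Each [x : V] is a leaf attached to the centre [phi x], so that edges
    correspond to elements of [V]; leaves and centres live in separate summands
    so that an edge determines its leaf, even when it is alone in its star. *)
Definition star_adj (p q : V + T) : Prop :=
  match p, q with
  | inl x, inr t | inr t, inl x => phi x = t
  | _, _ => False
  end.

Lemma star_adj_sym p q : star_adj p q -> star_adj q p.
Proof. by case: p q => [x|t] [y|s]. Qed.

Lemma star_adj_irrefl p : ~ star_adj p p.
Proof. by case: p => [x|t] []. Qed.

Definition star_forest : sgraph := SGraph star_adj_sym star_adj_irrefl.

Lemma star_edge_subproof (x : V) :
  @is_edge star_forest [set (inl x : V + T); inr (phi x)]%classic.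
Proof. by exists (inl x), (inr (phi x)). Qed.

Definition star_edge (x : V) : edge star_forest := exist _ _ (star_edge_subproof x).

Lemma star_edge_inj : injective star_edge.
Proof.
move=> x y /(congr1 sval) /= exy.
have : [set (inl y : V + T); inr (phi y)]%classic (inl x) by rewrite -exy; left.
by case=> // -[].
Qed.

Lemma star_edge_surj (e : edge star_forest) : exists x, star_edge x = e.
Proof.
have [[x|t] [[y|s] [/= // phiE e_pq]]] := svalP e.
- by exists x; apply: sval_prop_inj; rewrite e_pq /= phiE.
- by exists y; apply: sval_prop_inj; rewrite e_pq /= phiE setUC.
Qed.

Lemma star_edge_meet (x y : V) :
  (exists p, sval (star_edge x) p /\ sval (star_edge y) p) <-> phi x = phi y.
Proof.
split=> [[p [/= xp yp]]|phixy].
  by case: xp yp => -> [] // [->].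
by exists (inr (phi x)); split; right=> //=; rewrite phixy.
Qed.

End StarForest.

(** Each fibre of [phi] is a complete graph, and a complete graph is the line
    graph of a star: all edges of a star share its centre. *)
Lemma fiber_graph_is_line_graph (A : sgraph) (T : Type) (phi : A -> T) :
  (forall x y : A, adj x y <-> x <> y /\ phi x = phi y) -> is_line_graph A.
Proof.
move=> adjE; exists (star_forest phi); exists (star_edge phi).
  by apply: inj_surj_bijective; [exact: star_edge_inj | exact: star_edge_surj].
move=> x y; rewrite adjE /= /line_adj star_edge_meet.
by split=> -[nxy ?]; split=> // exy; apply: nxy;
  [exact: star_edge_inj exy | rewrite exy].
Qed.

(** * The commuting graph *)

Section Commuting.
Variables (gT : finGroupType) (G : {group gT}).
Local Open Scope group_scope.
Local Notation Gamma := (commuting_graph G).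
Local Notation Gamma' := (delete_dominating Gamma).

Lemma dominating_center (u : Gamma) : dominating u <-> sval u \in 'Z(G).
Proof.
split=> [dom_u|/centerP[_ cu] v nvu]; last first.
  by split; [exact: nesym | exact: cu (svalP v)].
apply/centerP; split=> [|y Gy]; first exact: svalP u.
have [/eqP -> //|nyu] := boolP (y == sval u).
have [] // := dom_u (exist _ y Gy).
by move=> /(congr1 sval) /= eyu; rewrite eyu eqxx in nyu.
Qed.

Definition noncentral_vertex (x : gT) (Gx : x \in G) (nZx : x \notin 'Z(G)) : Gamma' :=
  let u : Gamma := exist _ x Gx in
  exist _ u (fun dx => negP nZx (proj1 (dominating_center u) dx)).

Lemma vertex_in (u : Gamma') : sval (sval u) \in G.
Proof. exact: svalP (sval u). Qed.

Lemma vertex_noncentral (u : Gamma') : sval (sval u) \notin 'Z(G).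
Proof. by apply/negP=> /dominating_center; exact: svalP u. Qed.

Lemma noncommuting_notin_center (a b : gT) :
  b \in G -> ~ commute a b -> a \notin 'Z(G).
Proof. by move=> Gb nab; apply/negP=> /centerP[_ /(_ b Gb)]. Qed.

(** The product [a * b] supplies the third leaf: commuting with [a] or with
    [b] would force [a] and [b] to commute. *)
Lemma nonabelian_centralizer_claw (x : gT) :
  x \in G -> x \notin 'Z(G) -> ~~ abelian 'C_G[x] -> has_claw Gamma'.
Proof.
move=> Gx nZx /subsetPn[a /setIP[Ga /cent1P xa]] /centP ncent.
have [b [/setIP[Gb /cent1P xb] nab]] : exists b, b \in 'C_G[x] /\ ~ commute a b.
  apply: contra_notP ncent => no_b b Cb.
  by apply: contra_notP no_b => nab; exists b.
have Gab : a * b \in G by rewrite groupM.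
have n_a_ab : ~ commute a (a * b).
  by move=> h; apply: nab; apply: (mulgI a); rewrite h mulgA.
have n_b_ab : ~ commute b (a * b).
  by move=> h; apply: nab; apply: (mulIg b); rewrite -h mulgA.
have xab : commute x (a * b) by apply: commuteM.
have nba : ~ commute b a by move/commute_sym.
have n_ab_a : ~ commute (a * b) a by move/commute_sym.
pose vx : Gamma' := noncentral_vertex Gx nZx.
pose va : Gamma' := noncentral_vertex Ga (noncommuting_notin_center Gb nab).
pose vb : Gamma' := noncentral_vertex Gb (noncommuting_notin_center Ga nba).
pose vab : Gamma' := noncentral_vertex Gab (noncommuting_notin_center Ga n_ab_a).
have neq (u v : Gamma') : ~ commute (sval (sval u)) (sval (sval v)) -> u <> v.
  by move=> nuv euv; apply: nuv; rewrite euv.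
have nadj (u v : Gamma') : ~ commute (sval (sval u)) (sval (sval v)) -> ~ adj u v.
  by move=> nuv [].
have adjx (u : Gamma') y : commute x (sval (sval u)) -> commute x y ->
    ~ commute (sval (sval u)) y -> adj vx u.
  move=> xu xy nuy; split=> // exu; apply: nuy.
  by rewrite -(congr1 sval exu).
exists vx, va, vb, vab; split; last first.
  by split; split; (apply: neq || apply: nadj).
by split; [exact: (adjx _ b) | exact: (adjx _ a) | exact: (adjx _ a)].
Qed.

(** Any element of 'C_G[x] commutes with [y], because [y] lies in the abelian
    group 'C_G[x]; exchanging [x] and [y] gives the other inclusion. *)
Lemma commute_centralizer_eq (x y : gT) :
  x \in G -> y \in G -> abelian 'C_G[x] -> abelian 'C_G[y] ->
  commute x y <-> 'C_G[x] = 'C_G[y].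
Proof.
have sub u v : v \in G -> abelian 'C_G[u] -> commute u v -> 'C_G[u] \subset 'C_G[v].
  move=> Gv abu cuv; apply/fintype.subsetP=> z Cz; have [Gz _] := setIP Cz.
  rewrite inE Gz; apply/cent1P.
  by apply: (centsP abu) => //; rewrite inE Gv; apply/cent1P.
move=> Gx Gy abx aby; split=> [cxy|Cxy].
  by apply/eqP; rewrite finset.eqEsubset !sub //; exact: commute_sym.
have : y \in 'C_G[x] by rewrite Cxy inE Gy cent1id.
by case/setIP=> _ /cent1P.
Qed.

End Commuting.

Theorem theorem3p3 (gT : finGroupType) (G : {group gT})
    (nabG : ~~ abelian G) :
  is_line_graph (delete_dominating (commuting_graph G)) <->
  (forall x : gT, x \in G -> x \notin 'Z(G)%g -> abelian 'C_G[x]%g).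
Proof.
split=> [[B isoB] x Gx nZx|abC].
  apply/negPn/negP=> /(nonabelian_centralizer_claw Gx nZx) claw.
  exact: line_graph_claw_free (graph_iso_claw isoB claw).
apply: (@fiber_graph_is_line_graph (delete_dominating (commuting_graph G)) _
  (fun u => 'C_G[sval (sval u)]%g)) => u v.
have abu w := abC _ (vertex_in w) (vertex_noncentral w).
rewrite -(commute_centralizer_eq (vertex_in u) (vertex_in v) (abu u) (abu v)).
split=> -[nuv cuv]; split=> // euv; apply: nuv; first by rewrite euv.
exact: sval_prop_inj euv.
Qed.
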